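(* Let $(H,\mu)$ be a (commutative) Hilbertian Frobenius semigroup. Then $J(H,\mu)^{\perp}$, with the restriction of $\mu$ as multiplication, is unitarily isomorphic, as a semigroup, to $(\ell^2_{w_{(H,\mu)}}(G(H,\mu)),\mu_{G(H,\mu)})$, where $w_{(H,\mu)}\colon G(H,\mu)\to\left[\frac{1}{\|\mu\|_{\mathsf{op}}^2},+\infty\right[$ is $x\mapsto\frac{1}{\|x\|^2}$. (If $G(H,\mu)=\emptyset$, then $w_{(H,\mu)}$ stands for the empty map.)
   Context: All Hilbert spaces are complex; $\hat{\otimes}_2$ is the Hilbert space tensor product; $f^{\dagger}$ is the Hilbert adjoint and $\|\cdot\|_{\mathsf{op}}$ the operator norm. A Hilbertian semigroup is a pair $(H,\mu)$ with $H$ a Hilbert space and $\mu\colon H\hat{\otimes}_2H\to H$ bounded linear, associative and commutative (no unit assumed); write $xy:=\mu(x\otimes y)$. With $\alpha\colon (H\hat{\otimes}_2H)\hat{\otimes}_2H\to H\hat{\otimes}_2(H\hat{\otimes}_2H)$ the canonical unitary, it is a Hilbertian Frobenius semigroup when $(\mu\hat{\otimes}_2 id)\circ\alpha^{-1}\circ(id\hat{\otimes}_2\mu^{\dagger})=\mu^{\dagger}\circ\mu=(id\hat{\otimes}_2\mu)\circ\alpha\circ(\mu^{\dagger}\hat{\otimes}_2 id)$. $J(H,\mu)$ is the Jacobson radical of the commutative Banach algebra $H$ with product $(x,y)\mapsto xy$, i.e. the intersection of its maximal modular ideals, equivalently of the kernels of its non-zero algebra maps to $\mathbb{C}$; for a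 Hilbertian Frobenius semigroup, $J(H,\mu)^{\perp}$ is closed under multiplication. $G(H,\mu):=\{x\in H\setminus\{0\}\colon\mu^{\dagger}(x)=x\otimes x\}$. For a set $X$ and a map $w\colon X\to[C,+\infty[$ with $C>0$, $\ell^2_w(X)$ is the Hilbert space of functions $f\colon X\to\mathbb{C}$ with $\sum_{x\in X}w(x)|f(x)|^2<+\infty$, with inner product $\langle f,g\rangle_w=\sum_{x\in X}w(x)f(x)\overline{g(x)}$, and $\mu_X\colon\ell^2_w(X)\hat{\otimes}_2\ell^2_w(X)\to\ell^2_w(X)$ is the bounded linear map with $\mu_X(f\otimes g)=fg$ (pointwise product); for $X=\emptyset$ this is the zero algebra. A unitary isomorphism of semigroups is a unitary map preserving products. *)

(* Defs.v *)
From HB Require Import structures.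
From mathcomp Require Import all_boot all_order all_algebra.
From mathcomp Require Import all_classical all_reals all_analysis.
From mathcomp Require Import complex.
From mathcomp.analysis.showcase Require summability.

Set Implicit Arguments.
Unset Strict Implicit.
Unset Printing Implicit Defensive.

Import Order.TTheory GRing.Theory Num.Theory.
Import numFieldNormedType.Exports.

Local Open Scope classical_set_scope.
Local Open Scope complex_scope.
Local Open Scope ring_scope.

(* The inner product is linear in its first argument and conjugate-linear in
   its second one; the norm of a normedModType R[i] takes its values in R[i]. *)
HB.mixin Record CompleteNormedModule_isHilbert (R : realType) H
    of CompleteNormedModule R[i] H := {
  inner : {dot H for @Num.conj R[i]} ;
  inner_norm : forall x : H, inner x x = `|x| ^+ 2
}.

#[short(type="hilbertType")]
HB.structure Definition Hilbert (R : realType) :=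
  { H of CompleteNormedModule R[i] H & CompleteNormedModule_isHilbert R H }.

Definition hnorm (R : realType) (H : hilbertType R) (x : H) : R :=
  complex.Re `|x|.

Definition orthogonal_complement (R : realType) (H : hilbertType R)
    (A : set H) : set H :=
  [set x | forall a, A a -> inner x a = 0].

Section Operators.
Context {R : realType}.
Implicit Types H K : hilbertType R.

Definition bounded_linear H K (f : H -> K) : Prop :=
  linear f /\ exists M : R, forall x, hnorm (f x) <= M * hnorm x.

Definition opnorm H K (f : H -> K) : R :=
  sup [set hnorm (f x) | x in [set x | hnorm x <= 1]].

(* For bounded linear f, the Riesz theorem provides exactly one such z, so that
   the default value 0 is never used. *)
Definition adjoint H K (f : H -> K) (y : K) : H :=
  xget 0 [set z | forall x, inner (f x) y = inner x z].

Definition unitary H K (f : H -> K) : Prop :=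
  [/\ linear f, bijective f & forall x y, inner (f x) (f y) = inner x y].

End Operators.

(* A Hilbert tensor product of H and K is a completion of the algebraic tensor
   product for the inner product determined by tens_inner; it is unique up to
   a unique unitary map compatible with tens. *)
Record hilbertTensor (R : realType) (H K : hilbertType R) := HilbertTensor {
  tensor_space :> hilbertType R ;
  tens : {bilinear H -> K -> tensor_space} ;
  tens_inner : forall x x' y y',
    inner (tens x y) (tens x' y') = inner x x' * inner y y' ;
  tens_dense : dense [set z | exists n (x : 'I_n -> H) (y : 'I_n -> K),
    z = \sum_i tens (x i) (y i)]
}.

Section TensorMaps.
Context {R : realType}.

(* For bounded linear f and g there is exactly one F as below, so that the
   default value is never used. *)
Definition tensor_map (H K H' K' : hilbertType R)
    (T : hilbertTensor H K) (T' : hilbertTensor H' K')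
    (f : H -> H') (g : K -> K') : T -> T' :=
  xget (fun=> 0) [set F : T -> T' | bounded_linear F /\
    forall x y, F (tens T x y) = tens T' (f x) (g y)].

Definition associator (H K L : hilbertType R)
    (HK : hilbertTensor H K) (KL : hilbertTensor K L)
    (Tl : hilbertTensor HK L) (Tr : hilbertTensor H KL) : Tl -> Tr :=
  xget (fun=> 0) [set F : Tl -> Tr | unitary F /\
    forall x y z, F (tens Tl (tens HK x y) z) = tens Tr x (tens KL y z)].

Arguments associator {H K L HK KL} Tl Tr.

Definition associator_inv (H K L : hilbertType R)
    (HK : hilbertTensor H K) (KL : hilbertTensor K L)
    (Tl : hilbertTensor HK L) (Tr : hilbertTensor H KL) : Tr -> Tl :=
  'pinv_(fun=> 0) setT (associator Tl Tr).

End TensorMaps.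

Arguments tensor_map {R H K H' K'} T T' f g.
Arguments associator {R H K L HK KL} Tl Tr.
Arguments associator_inv {R H K L HK KL} Tl Tr.

Section Semigroup.
Context {R : realType} {H : hilbertType R} {T : hilbertTensor H H}.
Variable mu : T -> H.

Definition hmul (x y : H) : H := mu (tens T x y).

Definition hilbertian_semigroup : Prop :=
  [/\ bounded_linear mu, associative hmul & commutative hmul].

Definition frobenius (Tl : hilbertTensor T H) (Tr : hilbertTensor H T) : Prop :=
  tensor_map Tl T mu id \o associator_inv Tl Tr
      \o tensor_map T Tr id (adjoint mu)
    = adjoint mu \o mu
  /\ adjoint mu \o mu
    = tensor_map Tr T id mu \o associator Tl Tr
      \o tensor_map T Tl (adjoint mu) id.

Definition ideal (I : set H) : Prop :=
  [/\ I 0, forall (a : R[i]) x y, I x -> I y -> I (a *: x + y)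
    & forall x y, I y -> I (hmul x y)].

Definition modular (I : set H) : Prop := exists u, forall x, I (x - hmul u x).

(* An ideal containing a modular ideal is modular, hence maximality among
   proper modular ideals is maximality among proper ideals. *)
Definition maximal_modular_ideal (M : set H) : Prop :=
  [/\ ideal M, modular M, M <> setT
    & forall I, ideal I -> I <> setT -> M `<=` I -> I = M].

(* This is setT when there is no maximal modular ideal. *)
Definition jacobson_radical : set H :=
  \bigcap_(M in maximal_modular_ideal) M.

Definition grouplike : set H :=
  [set x | x <> 0 /\ adjoint mu x = tens T x x].

Definition grouplike_weight (x : grouplike) : R := (hnorm (val x) ^+ 2)^-1.

End Semigroup.

Section WeightedL2.
Context {R : realType} {X : choiceType}.
Variable w : X -> R.

Definition l2w : set (X -> R[i]^o) :=
  [set f | (\esum_(x in [set: X]) (w x * complex.Re `|f x| ^+ 2)%:E < +oo)%E].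

(* Unconditional sum, i.e. the limit over the finite subsets of X. *)
Definition l2w_inner (f g : X -> R[i]^o) : R[i] :=
  summability.sum (fun x => (w x)%:C * f x * Num.conj (g x) : R[i]^o).

Definition l2w_mul (f g : X -> R[i]^o) : X -> R[i]^o := fun x => f x * g x.

End WeightedL2.

(* A and B are linear subspaces of V and W, endowed with the inner products
   ipV and ipW and with the products mulV and mulW; only the restriction of U
   to A matters. *)
Definition unitary_semigroup_iso (R : realType) (V W : lmodType R[i])
    (A : set V) (ipV : V -> V -> R[i]) (mulV : V -> V -> V)
    (B : set W) (ipW : W -> W -> R[i]) (mulW : W -> W -> W)
    (U : V -> W) : Prop :=
  [/\ set_bij A B U,
      forall (a : R[i]) x y, A x -> A y -> U (a *: x + y) = a *: U x + U y,
      forall x y, A x -> A y -> ipW (U x) (U y) = ipV x y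
    & forall x y, A x -> A y -> U (mulV x y) = mulW (U x) (U y)].

(* Main.v *)
Require Import Defs.
From mathcomp Require Import all_boot all_order all_algebra.
From mathcomp Require Import all_classical all_reals all_analysis.
From mathcomp Require Import complex finmap ring lra.
From mathcomp.analysis.showcase Require summability.

Set Implicit Arguments.
Unset Strict Implicit.
Unset Printing Implicit Defensive.

Import Order.TTheory GRing.Theory Num.Theory.
Import numFieldNormedType.Exports.

Local Open Scope classical_set_scope.
Local Open Scope ring_scope.
Local Open Scope complex_scope.

(** Write [L_y] for the operator [x |-> xy].  Testing the Frobenius identity on
    elementary tensors turns it into [L_y^* (ab) = a (L_y^* b)]
    ([frobenius_hmul]): the adjoint of a multiplication commutes with all
    multiplications.  In particular every [L_y] is normal, so that
    [|L_y^* x| = |L_y x|] ([hnorm_adj]).  The rest of the proof is elementary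
    spectral theory of this commuting family of normal operators.

    Grouplike elements are exactly the vectors [g] such that [x |-> <x, g>] is a
    non-zero multiplicative functional ([grouplikeP]).  By normality they are
    common eigenvectors, [xg = <x, g> g]; hence distinct ones are orthogonal
    and their norm is at most the norm of [mu].

    The main point is that there are enough of them: if [L_v] is not zero, then
    some grouplike [g] is not orthogonal to [v] ([character_separates]).  Put
    [a = L_v^* v]; then [L_a = L_v^* L_v] is self-adjoint.  After scaling [L_a]
    to norm one, the even powers of [a] converge to a non-zero idempotent
    ([contraction_idempotent]).  Non-zero idempotents have norm at least
    [1 / |mu|] and orthogonal ones satisfy the Pythagorean identity, so only
    finitely many of them can add up to a given one and there is a minimal
    idempotent [f] below the one just found.  The idempotent produced by a
    self-adjoint [z] in [fH] must be [f], which forces [z^2], and likewise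
    [(f + z)^2], to be multiples of [f], and so [z] too.  Hence [fH] is the line
    spanned by [f] ([minimal_scalar]), and [f / |f|^2] is grouplike.

    Consequently the radical is the annihilator [{v | vH = 0}].  An annihilating
    [v] lies in every modular ideal, since [v - uv = v]; conversely the radical
    is contained in the kernels of all grouplike functionals.  So the orthogonal
    of the radical is the closed linear span of the orthogonal family of
    grouplike elements, and the theorems of Riesz-Fischer and Parseval identify
    it with the weighted sequence space through [x |-> (<x, g>)_g], which is
    multiplicative because every [g] is. *)

(** * Complex modulus and Hilbert space geometry *)

Section ComplexModulus.
Context {R : realType}.
Implicit Types z : R[i].

(** The modulus as an element of [R], where the order is total; likewise [hnorm]
    is used below in place of the [R[i]]-valued norm. *)
Definition cmod z : R := complex.Re `|z|.

Lemma cmodE z : (cmod z)%:C = `|z|.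
Proof. by rewrite /cmod RRe_real // normr_real. Qed.

Lemma cmod_ge0 z : 0 <= cmod z.
Proof. by rewrite -ler0c cmodE. Qed.

Lemma cmodM z z' : cmod (z * z') = cmod z * cmod z'.
Proof. by apply: (@complexI R); rewrite rmorphM /= !cmodE normrM. Qed.

Lemma cmodD z z' : cmod (z + z') <= cmod z + cmod z'.
Proof. by rewrite -lecR rmorphD /= !cmodE ler_normD. Qed.

Lemma cmod_eq0 z : cmod z = 0 -> z = 0.
Proof. by move=> z0; apply/eqP; rewrite -normr_eq0 -cmodE z0. Qed.

Lemma cmod_real (r : R) : cmod r%:C = `|r|.
Proof. by rewrite /cmod normc_def /= expr0n addr0 sqrtr_sqr. Qed.

Lemma Re_le_cmod z : complex.Re z <= cmod z.
Proof.
by rewrite (le_trans (ler_norm _)) // -lecR cmodE normc_ge_Re.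
Qed.

Lemma cmodJ z : cmod (Num.conj z) = cmod z.
Proof. by rewrite /cmod norm_conjC. Qed.

Lemma Re_conj z : complex.Re (Num.conj z) = complex.Re z.
Proof. by case: z. Qed.

Lemma Re_realM (r : R) z : @complex.Re R (r%:C * z) = r * complex.Re z.
Proof. by case: z => p q /=; rewrite mul0r subr0. Qed.

Lemma conj_real (r : R) : Num.conj (r%:C) = r%:C.
Proof. by rewrite conj_Creal // complex_real. Qed.

End ComplexModulus.

Section HilbertBasics.
Context {R : realType} {H : hilbertType R}.
Implicit Types (x y z : H) (a : R[i]).

Lemma innerC x y : inner x y = Num.conj (inner y x).
Proof. by rewrite hermC expr0 mul1r. Qed.

Lemma innerDl x y z : inner (x + y) z = inner x z + inner y z.
Proof. exact: linearDl. Qed.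

Lemma innerDr x y z : inner x (y + z) = inner x y + inner x z.
Proof. exact: linearDr. Qed.

Lemma innerBl x y z : inner (x - y) z = inner x z - inner y z.
Proof. exact: linearBl. Qed.

Lemma innerBr x y z : inner x (y - z) = inner x y - inner x z.
Proof. exact: linearBr. Qed.

Lemma innerZl a x y : inner (a *: x) y = a * inner x y.
Proof. exact: linearZl_LR. Qed.

Lemma innerZr a x y : inner x (a *: y) = Num.conj a * inner x y.
Proof. exact: linearZr_LR. Qed.

Lemma inner0l x : inner 0 x = 0.
Proof. exact: linear0l. Qed.

Lemma inner0r x : inner x 0 = 0.
Proof. exact: linear0r. Qed.

Lemma hnormE x : (hnorm x)%:C = `|x|.
Proof. by rewrite /hnorm RRe_real // normr_real. Qed.

Lemma hnorm_ge0 x : 0 <= hnorm x.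
Proof. by rewrite -ler0c hnormE. Qed.

Lemma hnorm0 : hnorm (0 : H) = 0.
Proof. by rewrite /hnorm normr0. Qed.

Lemma hnorm_eq0 x : hnorm x = 0 -> x = 0.
Proof. by move=> x0; apply/eqP; rewrite -normr_eq0 -hnormE x0. Qed.

Lemma hnormN x : hnorm (- x) = hnorm x.
Proof. by rewrite /hnorm normrN. Qed.

Lemma hnormZ a x : hnorm (a *: x) = cmod a * hnorm x.
Proof. by apply: (@complexI R); rewrite rmorphM /= !hnormE cmodE normrZ. Qed.

Lemma hnormD x y : hnorm (x + y) <= hnorm x + hnorm y.
Proof. by rewrite -lecR rmorphD /= !hnormE ler_normD. Qed.

Lemma hnormBC x y : hnorm (x - y) = hnorm (y - x).
Proof. by rewrite -hnormN opprB. Qed.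

Lemma inner_hnorm x : inner x x = (hnorm x ^+ 2)%:C.
Proof. by rewrite inner_norm -hnormE rmorphXn. Qed.

Lemma inner_eq0 x : inner x x = 0 -> x = 0.
Proof.
rewrite inner_hnorm => /complexI/eqP; rewrite sqrf_eq0 => /eqP.
exact: hnorm_eq0.
Qed.

Lemma inner_ext x y : (forall z, inner z x = inner z y) -> x = y.
Proof.
by move=> xy; apply/eqP; rewrite -subr_eq0; apply/eqP/inner_eq0;
   rewrite innerBr xy subrr.
Qed.

Lemma hnorm_sqrB x y :
  hnorm (x - y) ^+ 2 =
  hnorm x ^+ 2 + hnorm y ^+ 2 - 2 * complex.Re (inner x y).
Proof.
have sqE (u : H) : hnorm u ^+ 2 = complex.Re (inner u u) by rewrite inner_hnorm.
rewrite !sqE innerBl !innerBr !raddfB /= (innerC y x) Re_conj.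
by lra.
Qed.

Lemma hnorm_sqrD x y :
  hnorm (x + y) ^+ 2 =
  hnorm x ^+ 2 + hnorm y ^+ 2 + 2 * complex.Re (inner x y).
Proof.
by rewrite -[y in LHS]opprK hnorm_sqrB hnormN -[- y]add0r innerBr inner0r
   sub0r raddfN /= mulrN opprK.
Qed.

Lemma Re_inner_le x y : complex.Re (inner x y) <= hnorm x * hnorm y.
Proof.
have [y0|y0] := eqVneq (hnorm y) 0.
  by rewrite (hnorm_eq0 y0) inner0r hnorm0 mulr0.
have [x0|x0] := eqVneq (hnorm x) 0.
  by rewrite (hnorm_eq0 x0) inner0l hnorm0 mul0r.
have px : 0 < hnorm x by rewrite lt0r x0 hnorm_ge0.
have py : 0 < hnorm y by rewrite lt0r y0 hnorm_ge0.
have := sqr_ge0 (hnorm ((hnorm y)%:C *: x - (hnorm x)%:C *: y)).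
rewrite hnorm_sqrB !hnormZ !cmod_real !ger0_norm ?hnorm_ge0 //.
rewrite innerZl innerZr conj_real.
rewrite mulrA -rmorphM Re_realM.
move=> h; have pxy := mulr_gt0 px py.
by rewrite -(ler_pM2l pxy); nra.
Qed.

(** Multiplying [x] by a unimodular scalar makes [<x, y>] real, which reduces
    the inequality to the one on real parts. *)
Lemma cauchy_schwarz x y : cmod (inner x y) <= hnorm x * hnorm y.
Proof.
have [c0|c0] := eqVneq (cmod (inner x y)) 0.
  by rewrite c0 mulr_ge0 ?hnorm_ge0.
set c := inner x y in c0 *.
(* The unimodular number rotating c onto the positive real axis. *)
pose a := Num.conj c * ((cmod c)^-1)%:C.
have a1 : cmod a = 1.
  by rewrite cmodM cmodJ cmod_real ger0_norm ?invr_ge0 ?cmod_ge0 // divff.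
have -> : cmod c = complex.Re (inner (a *: x) y).
  rewrite innerZl -/c /a mulrAC [Num.conj c * c]mulrC -normCK -cmodE.
  by rewrite -rmorphXn -rmorphM /= expr2 mulfK.
by rewrite (le_trans (Re_inner_le _ _)) // hnormZ a1 mul1r.
Qed.

End HilbertBasics.

Section Convergence.
Context {R : realType} {H : hilbertType R} {I : Type}.
Variables (F : set_system I) (FF : ProperFilter F).
Implicit Types (u : I -> H) (l : H).

Lemma hnorm_cvg u l : u @ F --> l ->
  forall e : R, 0 < e -> \forall i \near F, hnorm (u i - l) < e.
Proof.
move=> /cvgrPdist_lt ul e e0.
have e0' : (0 : R[i]) < e%:C by rewrite ltcR.
have := ul _ e0'; apply: filterS => i.
by rewrite -hnormE ltcR hnormBC.
Qed.

(** Stated for an arbitrary filter because it serves for sequences and for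
    sums along the filter of finite subsets. *)
Lemma hilbert_complete u :
  (forall e : R, 0 < e -> exists x, \forall i \near F, hnorm (u i - x) < e) ->
  exists l, forall e : R, 0 < e -> \forall i \near F, hnorm (u i - l) < e.
Proof.
move=> uC; suff ul : cvg (u @ F) by exists (lim (u @ F)); apply: hnorm_cvg.
apply: cauchy_cvg; apply/cauchyP => e e0.
have eE : (complex.Re e)%:C = e by rewrite RRe_real // gtr0_real.
have e0' : 0 < complex.Re e by rewrite -ltcR eE.
have [x ux] := uC _ e0'; exists x; apply: filterS ux => i.
by rewrite -ltcR hnormE eE -ball_normE /= distrC.
Qed.
End Convergence.

Lemma le_eps_eq0 (R : realType) (x c : R) :
  (forall e : R, 0 < e -> `|x| <= e * c) -> x = 0.
Proof.
move=> xc; apply/eqP; rewrite -normr_le0 leNgt; apply/negP => x0.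
have c0 : 0 < c by have := xc 1 ltr01; rewrite mul1r; apply: lt_le_trans.
have := xc (`|x| / (2 * c)) (divr_gt0 x0 (mulr_gt0 (ltr0Sn _ _) c0)).
have -> : `|x| / (2 * c) * c = `|x| / 2 by field; rewrite gt_eqF.
lra.
Qed.

Lemma eventually_inv_lt (R : realType) (e : R) : 0 < e ->
  \forall n \near \oo, n.+1%:R^-1 < e.
Proof. by move=> e0; have := near_infty_natSinv_lt (PosNum e0). Qed.

(** * Riesz representation and adjoints *)

Section Riesz.
Context {R : realType} {H : hilbertType R}.
Variables (phi : H -> R[i]) (M : R).
Hypothesis phiL : forall a x y, phi (a *: x + y) = a * phi x + phi y.
Hypothesis phiM : forall x, cmod (phi x) <= M * hnorm x.

Let phi0 : phi 0 = 0.
Proof. by have := phiL (-1) 0 0; rewrite scaleN1r oppr0 addr0 mulN1r addNr. Qed.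

(** The quadratic functional [|u|^2 - 2 Re phi(u)] is bounded below and its
    minimum would represent [phi].  At an almost minimal [u], nonnegativity of
    its variation [2tA + t^2|h|^2 + e^2] along the real line [u + th] bounds
    the defect [A]. *)
Lemma riesz_approx (e : R) : 0 < e -> exists u, forall h,
  `|complex.Re (inner h u - phi h)| <= e * hnorm h.
Proof.
move=> e0; pose J u := hnorm u ^+ 2 - 2 * complex.Re (phi u).
have Jinf : has_inf (range J).
  split; first by exists (J 0), 0.
  exists (- M ^+ 2) => _ [u _ <-]; rewrite /J.
  have := le_trans (Re_le_cmod (phi u)) (phiM u).
  have := sqr_ge0 (hnorm u - M); nra.
have [_ [u _ <-] Ju] := inf_adherent (exprn_gt0 2 e0) Jinf.
exists u => h; rewrite raddfB /=.
set A := _ - _.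
have Jt (t : R) : 0 <= 2 * t * A + t ^+ 2 * hnorm h ^+ 2 + e ^+ 2.
  have := ge_inf Jinf.2 (imageT J (t%:C *: h + u)).
  have := Ju; rewrite {1 4}/J hnorm_sqrD phiL innerZl raddfD /= !Re_realM.
  rewrite hnormZ cmod_real exprMn -normrX ger0_norm ?sqr_ge0 // /A.
  move: (complex.Re _) (complex.Re _) (complex.Re _) (inf _) => *; lra.
have [h0|h0] := eqVneq (hnorm h) 0.
  by rewrite /A (hnorm_eq0 h0) inner0l phi0 subrr normr0 hnorm0 mulr0.
have ph : 0 < hnorm h by rewrite lt0r h0 hnorm_ge0.
(* The minimizer of the quadratic polynomial in t. *)
have := Jt (- A / hnorm h ^+ 2).
have -> : 2 * (- A / hnorm h ^+ 2) * A +
  (- A / hnorm h ^+ 2) ^+ 2 * hnorm h ^+ 2 + e ^+ 2 =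
  e ^+ 2 - A ^+ 2 / hnorm h ^+ 2 by field.
rewrite subr_ge0 ler_pdivrMr ?exprn_gt0 // -exprMn.
rewrite -[A ^+ 2]real_normK ?num_real //.
by rewrite ler_sqr ?nnegrE ?mulr_ge0 ?hnorm_ge0 // ltW.
Qed.

(** Approximate representatives [u], [u'] with errors [d], [d'] satisfy
    [|u - u'| <= d + d'], as one sees by testing both on [u - u']; so they form
    a Cauchy sequence, whose limit represents [phi]. *)
Lemma riesz : exists z, forall x, phi x = inner x z.
Proof.
have approx n : exists u : H, forall h,
    `|complex.Re (inner h u - phi h)| <= n.+1%:R^-1 * hnorm h.
  by apply: riesz_approx; rewrite invr_gt0 ltr0n.
have [u uP] := choice approx.
have u_close m n : hnorm (u m - u n) <= m.+1%:R^-1 + n.+1%:R^-1.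
  set h := u m - u n.
  have [h0|h0] := eqVneq (hnorm h) 0.
    by rewrite h0 addr_ge0 ?invr_ge0 ?ler0n.
  have ph : 0 < hnorm h by rewrite lt0r h0 hnorm_ge0.
  have hE : complex.Re (inner h (u m) - phi h) -
            complex.Re (inner h (u n) - phi h) = hnorm h * hnorm h.
    rewrite -raddfB /= opprB addrA subrK -innerBr -/h inner_hnorm /=.
    by rewrite expr2.
  rewrite -(ler_pM2r ph) -hE (le_trans (ler_norm _)) //.
  by rewrite (le_trans (ler_normB _ _)) // mulrDl lerD.
have [|l ul] := @hilbert_complete R H nat \oo _ u.
  move=> e e0; have e2 : 0 < e / 2 by rewrite divr_gt0.
  have [N _ eN] := eventually_inv_lt e2.
  exists (u N); exists N => // n Nn; apply: le_lt_trans (u_close n N) _.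
  have /= n2 := eN n Nn; have /= N2 := eN N (leqnn N).
  by rewrite [ltRHS]splitr ltrD.
have lP h : complex.Re (phi h) = complex.Re (inner h l).
  apply/esym/eqP; rewrite -subr_eq0; apply/eqP.
  apply: (@le_eps_eq0 _ _ (2 * hnorm h)) => e e0.
  have [n [/= un en]] := filter_ex (filterI (ul e e0) (eventually_inv_lt e0)).
  rewrite -raddfB /= -(subrK (inner h (u n)) (inner h l)) -addrA -innerBr.
  rewrite raddfD /= (le_trans (ler_normD _ _)) //.
  have h1 : `|complex.Re (inner h (l - u n))| <= hnorm h * e.
    rewrite (@le_trans _ _ (cmod (inner h (l - u n)))) //.
      by rewrite -lecR cmodE normc_ge_Re.
    rewrite (le_trans (cauchy_schwarz _ _)) // ler_wpM2l ?hnorm_ge0 // hnormBC.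
    exact: ltW.
  have := uP n h; have := hnorm_ge0 h; move: h1 en => /=.
  move: (hnorm h) (n.+1%:R^-1) `|_| `|_| => a b c d; nra.
(* The real part at 'i *: x is, up to sign, the imaginary part at x. *)
exists l => x; have := lP x; have := lP ('i *: x).
have -> : phi ('i *: x) = 'i * phi x.
  by have := phiL 'i x 0; rewrite !addr0 phi0 addr0.
rewrite innerZl; case: (phi x) (inner x l) => a b [c d] /=.
by rewrite !mul0r !mul1r !sub0r => /oppr_inj -> ->.
Qed.

End Riesz.

Lemma adjointP (R : realType) (H K : hilbertType R) (f : H -> K) :
  bounded_linear f -> forall x y, inner (f x) y = inner x (adjoint f y).
Proof.
move=> [fL [M fM]] x y; rewrite /adjoint.
case: xgetP => [z _ /= -> //|no_z].
have [z zP] : exists z, forall x, inner (f x) y = inner x z.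
  apply: (@riesz R H (fun x => inner (f x) y) (M * hnorm y)).
  - by move=> a u v; rewrite fL innerDl innerZl.
  - move=> u; rewrite (le_trans (cauchy_schwarz _ _)) // mulrAC.
    by rewrite ler_wpM2r ?hnorm_ge0.
by case: (no_z z).
Qed.

Section BoundedLinear.
Context {R : realType}.
Implicit Types H K L : hilbertType R.

Lemma unit_ball_has_sup H K (f : H -> K) : bounded_linear f ->
  has_sup [set hnorm (f x) | x in [set x | hnorm x <= 1]].
Proof.
move=> [_ [M fM]]; split.
  by exists (hnorm (f 0)), 0 => //=; rewrite hnorm0 ler01.
exists `|M| => _ [x /= x1 <-]; rewrite (le_trans (fM x)) //.
rewrite (le_trans (ler_norm _)) // normrM [X in _ * X]ger0_norm ?hnorm_ge0 //.
by rewrite ler_piMr.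
Qed.

Lemma linear_fct0 H K (f : H -> K) : linear f -> f 0 = 0.
Proof. by move=> fL; have := fL (-1) 0 0; rewrite !scaleN1r !addNr. Qed.

Lemma linear_fctZ H K (f : H -> K) (a : R[i]) x :
  linear f -> f (a *: x) = a *: f x.
Proof. by move=> fL; have := fL a x 0; rewrite (linear_fct0 fL) !addr0. Qed.

Lemma le_opnorm H K (f : H -> K) x : bounded_linear f ->
  hnorm (f x) <= opnorm f * hnorm x.
Proof.
move=> fB; have [fL _] := fB; have [x0|x0] := eqVneq (hnorm x) 0.
  by rewrite (hnorm_eq0 x0) (linear_fct0 fL) !hnorm0 mulr0.
have px : 0 < hnorm x by rewrite lt0r x0 hnorm_ge0.
rewrite -ler_pdivrMr //.
have -> : hnorm (f x) / hnorm x = hnorm (f ((hnorm x)^-1%:C *: x)).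
  rewrite (linear_fctZ _ _ fL) hnormZ cmod_real.
  by rewrite ger0_norm ?invr_ge0 ?hnorm_ge0 // mulrC.
apply: ub_le_sup; first exact: (unit_ball_has_sup fB).2.
exists ((hnorm x)^-1%:C *: x) => //=.
by rewrite hnormZ cmod_real ger0_norm ?invr_ge0 ?hnorm_ge0 // mulVf.
Qed.

Lemma opnorm_ge0 H K (f : H -> K) : bounded_linear f -> 0 <= opnorm f.
Proof.
move=> fB; apply: (@le_trans _ _ (hnorm (f 0))); first exact: hnorm_ge0.
apply: ub_le_sup; first exact: (unit_ball_has_sup fB).2.
by exists 0 => //=; rewrite hnorm0 ler01.
Qed.

Lemma bounded_linear_comp H K L (f : K -> L) (g : H -> K) :
  bounded_linear f -> bounded_linear g -> bounded_linear (f \o g).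
Proof.
move=> fB gB; split=> [a x y|]; first by rewrite /= gB.1 fB.1.
exists (opnorm f * opnorm g) => x; rewrite (le_trans (le_opnorm _ fB)) //.
by rewrite -mulrA ler_wpM2l ?opnorm_ge0 ?le_opnorm.
Qed.

Lemma unitary_bounded_linear H K (f : H -> K) : unitary f -> bounded_linear f.
Proof.
move=> [fL _ fI]; split=> //; exists 1 => x; rewrite mul1r le_eqVlt.
rewrite -(@eqrXn2 _ 2) ?hnorm_ge0 //; apply/orP; left; apply/eqP/(@complexI R).
by rewrite -!inner_hnorm.
Qed.

End BoundedLinear.

(** * Elementary tensors determine vectors *)

Section TensorProduct.
Context {R : realType} {H K : hilbertType R} (T : hilbertTensor H K).

Lemma hnorm_tens x y : hnorm (tens T x y) = hnorm x * hnorm y.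
Proof.
apply/eqP; rewrite -(@eqrXn2 _ 2) ?mulr_ge0 ?hnorm_ge0 //.
apply/eqP/(@complexI R).
by rewrite -inner_hnorm tens_inner !inner_hnorm -rmorphM exprMn.
Qed.

Lemma tens_total (z : T) : (forall x y, inner (tens T x y) z = 0) -> z = 0.
Proof.
move=> z0; apply/hnorm_eq0/(@le_eps_eq0 _ _ 1) => e e0.
rewrite mulr1 ger0_norm ?hnorm_ge0 //.
have eC : (0 : R[i]) < e%:C by rewrite ltcR.
have [t [ze [n [x [y tE]]]]] := @tens_dense _ _ _ T _
  (ex_intro _ z (ballxx z eC)) (ball_open z e%:C).
have tz : inner z t = 0.
  rewrite innerC tE; elim/big_ind: _ => [|u v hu hv|i _].
  - by rewrite inner0l rmorph0.
  - by rewrite innerDl rmorphD /= hu hv addr0.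
  - by rewrite z0 rmorph0.
have ze' : hnorm (z - t) < e.
  have : ball_ Num.norm z e%:C t by rewrite ball_normE.
  by rewrite /ball_ /= -hnormE ltcR.
have := cauchy_schwarz z (z - t).
rewrite innerBr tz subr0 inner_hnorm cmod_real ger0_norm ?sqr_ge0 //.
have := hnorm_ge0 z; rewrite le_eqVlt => /orP[/eqP <- _|pz]; first exact: ltW.
rewrite expr2 ler_pM2l // => h; exact: le_trans h (ltW ze').
Qed.

Lemma tens_inner_ext (z z' : T) :
  (forall x y, inner (tens T x y) z = inner (tens T x y) z') -> z = z'.
Proof.
move=> zz'; apply/eqP; rewrite -subr_eq0; apply/eqP/tens_total => x y.
by rewrite innerBr zz' subrr.
Qed.

Lemma tensl_bounded_linear y : bounded_linear ((tens T)^~ y).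
Proof.
split=> [a x x'|]; first by rewrite linearPl.
by exists (hnorm y) => x; rewrite hnorm_tens mulrC.
Qed.

Lemma tensr_bounded_linear x : bounded_linear (tens T x).
Proof.
split=> [a y y'|]; first by rewrite linearPr.
by exists (hnorm x) => y; rewrite hnorm_tens.
Qed.

End TensorProduct.

(** * Commutative algebras whose multiplications have commuting adjoints *)

Section Algebra.
Context {R : realType} {H : hilbertType R}.
(* m is the product and s y is the adjoint of the multiplication by y. *)
Variables (m s : H -> H -> H) (M : R).
Hypothesis mL : forall x (a : R[i]) y z, m x (a *: y + z) = a *: m x y + m x z.
Hypothesis mC : commutative m.
Hypothesis mA : associative m.
Hypothesis M_ge0 : 0 <= M.
Hypothesis mM : forall x y, hnorm (m x y) <= M * (hnorm x * hnorm y).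
Hypothesis sP : forall y x z, inner (m y x) z = inner x (s y z).
Hypothesis frob : forall y a b, s y (m a b) = m a (s y b).

Lemma amulDr x y z : m x (y + z) = m x y + m x z.
Proof. by have := mL x 1 y z; rewrite !scale1r. Qed.

Lemma amul0r x : m x 0 = 0.
Proof. by apply: (@addrI _ (m x 0)); rewrite -amulDr !addr0. Qed.

Lemma amulZr (a : R[i]) x y : m x (a *: y) = a *: m x y.
Proof. by have := mL x a y 0; rewrite amul0r !addr0. Qed.

Lemma amulBr x y z : m x (y - z) = m x y - m x z.
Proof. by rewrite -scaleN1r amulDr amulZr scaleN1r. Qed.

Lemma amulDl x y z : m (x + y) z = m x z + m y z.
Proof. by rewrite mC amulDr !(mC z). Qed.

Lemma amulBl x y z : m (x - y) z = m x z - m y z.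
Proof. by rewrite mC amulBr !(mC z). Qed.

Lemma amulZl (a : R[i]) x y : m (a *: x) y = a *: m x y.
Proof. by rewrite mC amulZr mC. Qed.

Definition selfadj b := forall y z, inner (m b y) z = inner y (m b z).

Lemma selfadjD b c : selfadj b -> selfadj c -> selfadj (b + c).
Proof. by move=> hb hc y z; rewrite !amulDl innerDl innerDr hb hc. Qed.

Lemma selfadjZ (r : R) b : selfadj b -> selfadj (r%:C *: b).
Proof. by move=> hb y z; rewrite !amulZl innerZl innerZr conj_real hb. Qed.

(** Normality: [<s_y x, s_y x> = <L_y s_y x, x> = <s_y L_y x, x>
    = <L_y x, L_y x>]. *)
Lemma hnorm_adj y x : hnorm (s y x) = hnorm (m y x).
Proof.
apply/eqP; rewrite -(@eqrXn2 _ 2) ?hnorm_ge0 //; apply/eqP/(@complexI R).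
by rewrite -!inner_hnorm -sP -frob innerC -sP -innerC.
Qed.

(** ** A self-adjoint contraction of norm one yields an idempotent *)

Section Contraction.
Variable a : H.
Hypothesis aS : selfadj a.
Hypothesis a_contr : forall y, hnorm (m a y) <= hnorm y.
Hypothesis a_sharp : forall e : R, 0 < e ->
  exists y, hnorm y <= 1 /\ 1 - e < hnorm (m a y).

Let S := m a.
Let b := m a a.
(* u n is the power a^(2n+2); only even powers converge, as a may act as -1. *)
Let u n := iter (n + n) S b.

Let S_adj n x y : inner (iter n S x) y = inner x (iter n S y).
Proof. by elim: n y => // n IHn y; rewrite iterS aS IHn -iterSr. Qed.

Let iterM n x y : m (iter n S x) y = iter n S (m x y).
Proof. by elim: n => // n IHn; rewrite /= /S -mA IHn. Qed.

Let uM n y : m (u n) y = iter (n + n).+2 S y.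
Proof. by rewrite iterM !iterSr /b -mA. Qed.

Let uS n : u n.+1 = S (S (u n)).
Proof. by rewrite /u addSn addnS. Qed.

(** From [|Sy|^2 = <y, S^2 y> <= |y| |S^2 y|] and the inequality between the
    geometric and the arithmetic mean: the norms [|S^k y|] form a convex
    sequence. *)
Lemma hnorm_convex y : 2 * hnorm (S y) <= hnorm y + hnorm (S (S y)).
Proof.
rewrite -ler_sqr ?nnegrE ?addr_ge0 ?mulr_ge0 ?hnorm_ge0 //.
have : hnorm (S y) ^+ 2 <= hnorm y * hnorm (S (S y)).
  by rewrite -lecR -inner_hnorm aS; have := Re_inner_le y (S (S y));
     rewrite -lecR; apply: le_trans; rewrite /S -aS inner_hnorm.
have := sqr_ge0 (hnorm y - hnorm (S (S y))); nra.
Qed.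

(** A convex sequence decreases at most as fast as its first step.  This
    transfers [|Sy|] close to [|y|] to all iterates, and so shows that the
    powers of [S] also have norm one. *)
Lemma hnorm_iter_ge n y :
  hnorm y - n%:R * (hnorm y - hnorm (S y)) <= hnorm (iter n S y).
Proof.
have decr k : hnorm (iter k S y) - hnorm (iter k.+1 S y)
    <= hnorm y - hnorm (S y).
  elim: k => // k IHk; apply: le_trans IHk.
  by have := hnorm_convex (iter k S y) => /=; lra.
elim: n => [|n IHn]; first by rewrite mul0r subr0.
by have := decr n; rewrite -natr1; lra.
Qed.

Let u_big n : 1 <= M * hnorm (u n).
Proof.
suff le_e (e : R) : 0 < e -> 1 <= M * hnorm (u n) + e by apply/ler_addgt0Pr.
move=> e0; set k := (n + n).+2.
have [d d0 eE] : exists2 d : R, 0 < d & e = k%:R * d + d.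
  exists (e / k.+1%:R); first by rewrite divr_gt0.
  by rewrite -[X in _ + X]mul1r -mulrDl natr1 mulrC divfK.
have [y [y1 ay]] := a_sharp d0.
have Mu : 0 <= M * hnorm (u n) by rewrite mulr_ge0 ?hnorm_ge0.
have le_Mu : hnorm (iter k S y) <= M * hnorm (u n).
  by rewrite -uM (le_trans (mM _ _)) // mulrA ler_piMr.
have gap : k%:R * (hnorm y - hnorm (S y)) <= k%:R * d.
  by apply: ler_wpM2l => //; move: ay; rewrite -/(S y); lra.
have := hnorm_iter_ge k y; have := a_contr y; move: ay gap le_Mu.
rewrite -/(S y) eE; lra.
Qed.

Let tau n := hnorm (iter n S b) ^+ 2.

Let inner_u i j : complex.Re (inner (u i) (u j)) = tau (i + j).
Proof.
rewrite S_adj -iterD (_ : (i + i + (j + j) = (i + j) + (i + j))%N).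
  by rewrite iterD -S_adj inner_hnorm.
by rewrite addnACA.
Qed.

Let tau_anti i j : (i <= j)%N -> tau j <= tau i.
Proof.
move=> /subnK <-; elim: (j - i)%N => // n; apply: le_trans.
by rewrite ler_sqr ?nnegrE ?hnorm_ge0 // addSn; apply: a_contr.
Qed.

(** With [tau n = |S^n b|^2] nonincreasing and [<u_i, u_j> = tau (i + j)], one
    has [|u_i - u_j|^2 = tau (2i) + tau (2j) - 2 tau (i + j)], which tends to
    [0]: the even powers of [a] converge.  The limit is non-zero because
    multiplication by [u_n] has norm one, so that [1 <= M |u_n|]. *)
Lemma contraction_idempotent :
  exists e, [/\ m e e = e, e <> 0 & m a (m a e) = e].
Proof.
have tau_inf : has_inf (range tau).
  by split; [exists (tau 0%N), 0%N | exists 0 => _ [n _ <-]; apply: sqr_ge0].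
have [|e ue] := @hilbert_complete R H nat \oo _ u.
  move=> e e0; have e4 : 0 < e ^+ 2 / 4 by rewrite divr_gt0 ?exprn_gt0.
  have [_ [N _ <-] tN] := inf_adherent e4 tau_inf.
  exists (u N), N => // n /= Nn.
  rewrite -ltr_sqr ?nnegrE ?hnorm_ge0 1?ltW // hnorm_sqrB inner_u.
  have := ge_inf tau_inf.2 (imageT tau (n + N)%N).
  have := @tau_anti N (n + n)%N (leq_trans Nn (leq_addr _ _)).
  have := @tau_anti N (N + N)%N (leq_addr _ _).
  by rewrite -/(tau _) -/(tau _); lra.
have aae : m a (m a e) = e.
  apply/eqP; rewrite -subr_eq0; apply/eqP/hnorm_eq0.
  apply: (@le_eps_eq0 _ _ 2) => d d0; rewrite ger0_norm ?hnorm_ge0 //.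
  have [n [/= un uSn]] :
      exists n, hnorm (u n - e) < d /\ hnorm (u n.+1 - e) < d.
    have [N _ uN] := ue d d0; exists N.
    by split; apply: uN; [exact: leqnn | exact: leqnSn].
  rewrite -(subrK (u n.+1) (m a (m a e))) -addrA (le_trans (hnormD _ _)) //.
  have -> : m a (m a e) - u n.+1 = m a (m a (e - u n)).
    by rewrite uS /S !amulBr.
  have := a_contr (m a (e - u n)); have := a_contr (e - u n).
  rewrite [in X in X -> _](hnormBC e) => h1 h2.
  by rewrite mulr_natr mulr2n lerD ?ltW // (le_lt_trans h2) // (le_lt_trans h1).
have ue_e n : m (u n) e = e.
  elim: n => [|n IHn]; first by rewrite /u /b /= -mA aae.
  by rewrite uS /S -!mA IHn aae.
exists e; split => //.
  apply/eqP; rewrite -subr_eq0; apply/eqP/hnorm_eq0.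
  apply: (@le_eps_eq0 _ _ (M * hnorm e)) => d d0.
  have [n /= un] := filter_ex (ue d d0).
  rewrite ger0_norm ?hnorm_ge0 // -{3}(ue_e n) -amulBl (le_trans (mM _ _)) //.
  by rewrite mulrCA ler_wpM2r ?mulr_ge0 ?hnorm_ge0 // hnormBC ltW.
move=> e_eq0.
have [M0|M0] := eqVneq M 0; first by have := u_big 0; rewrite M0 mul0r ler10.
have pM : 0 < M by rewrite lt0r M0.
have iM : 0 < M^-1 by rewrite invr_gt0.
have [n /= un] := filter_ex (ue _ iM).
have := u_big n; rewrite leNgt -ltr_pdivlMl // mulr1.
by rewrite e_eq0 subr0 in un; rewrite un.
Qed.

End Contraction.

(** Scaling by the inverse of the operator norm gives the previous situation;
    [r] is the square of that norm. *)
Lemma selfadj_idempotent a : selfadj a -> (exists y, m a y <> 0) ->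
  exists r : R, exists e,
    [/\ 0 < r, m e e = e, e <> 0 & m a (m a e) = r%:C *: e].
Proof.
move=> aS [y0 ay0].
have aB : bounded_linear (m a).
  by split=> [r x y|]; [exact: mL | exists (M * hnorm a) => y; rewrite -mulrA].
pose c := opnorm (m a).
have ac y : hnorm (m a y) <= c * hnorm y by apply: le_opnorm.
have c0 : 0 < c.
  have ay0' : 0 < hnorm (m a y0).
    rewrite lt0r hnorm_ge0 andbT; apply/eqP => /hnorm_eq0; exact: ay0.
  have cy0 := lt_le_trans ay0' (ac y0).
  rewrite ltNge; apply/negP => cle0; move: cy0.
  by rewrite ltNge mulr_le0_ge0 ?hnorm_ge0.
pose a' := c^-1%:C *: a.
have a'E y : hnorm (m a' y) = c^-1 * hnorm (m a y).
  by rewrite amulZl hnormZ cmod_real ger0_norm // invr_ge0 ltW.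
have [|y|e e0|e [ee e_neq0 aae]] := @contraction_idempotent a'.
- exact: selfadjZ.
- by rewrite a'E ler_pdivrMl.
- have [_ [y /= y1 <-] ay] :=
    sup_adherent (mulr_gt0 c0 e0) (unit_ball_has_sup aB).
  exists y; split => //; rewrite a'E ltr_pdivlMl //.
  by rewrite mulrBr mulr1.
exists (c ^+ 2), e; split => //; first exact: exprn_gt0.
rewrite -[in RHS]aae !amulZl amulZr !scalerA -!rmorphM /=.
by rewrite expr2 mulfK ?gt_eqF // divff ?gt_eqF // scale1r.
Qed.

(** A normal idempotent is an orthogonal projection: [z - ez] is killed by
    [L_e], hence by its adjoint. *)
Lemma idempotent_selfadj e : m e e = e -> selfadj e.
Proof.
move=> ee x y.
have ann z : m e (z - m e z) = 0 by rewrite amulBr mA ee subrr.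
have exy z t : inner (m e z) t = inner (m e z) (m e t).
  rewrite -[X in inner _ X](subrK (m e t)) innerDr [X in X + _]sP.
  by rewrite (_ : s e _ = 0) ?inner0r ?add0r //; apply/hnorm_eq0;
    rewrite hnorm_adj ann hnorm0.
by rewrite exy [RHS]innerC [in RHS]exy -innerC.
Qed.

Lemma idempotent_hnorm_ge e : m e e = e -> e <> 0 -> 1 <= M * hnorm e.
Proof.
move=> ee e0; have pe : 0 < hnorm e.
  by rewrite lt0r hnorm_ge0 andbT; apply/eqP => /hnorm_eq0.
by rewrite -(ler_pM2r pe) mul1r -mulrA -{1}ee; apply: mM.
Qed.

(** ** Minimal idempotents span lines *)

Definition minimal_idempotent f := [/\ m f f = f, f <> 0
  & forall g, m g g = g -> m g f = g -> g <> 0 -> g = f].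

(** Take [f] below [e] whose squared norm is within [1 / M^2] of the infimum.
    If [g] were strictly between [0] and [f], then [f - g] would be an
    idempotent orthogonal to [g], of squared norm at least [1 / M^2], and
    [|g|^2 = |f|^2 - |f - g|^2] would fall below the infimum. *)
Lemma exists_minimal_idempotent e : m e e = e -> e <> 0 ->
  exists2 f, minimal_idempotent f & m f e = f.
Proof.
move=> ee e0.
pose A := [set hnorm f ^+ 2 |
  f in [set f | [/\ m f f = f, f <> 0 & m f e = f]]].
have A_inf : has_inf A.
  split; first by exists (hnorm e ^+ 2), e.
  by exists 0 => _ [f _ <-]; apply: sqr_ge0.
have pM : 0 < M.
  rewrite lt0r M_ge0 andbT; apply/eqP => M0.
  by have := idempotent_hnorm_ge ee e0; rewrite M0 mul0r ler10.
have pM2 : 0 < (M ^+ 2)^-1 by rewrite invr_gt0 exprn_gt0.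
have [_ [f [ff f0 fe] <-] fA] := inf_adherent pM2 A_inf.
exists f => //; split => // g gg gf g0; apply: contrapT => g_neq_f.
have h0 : f - g <> 0 by move/eqP; rewrite subr_eq0 => /eqP /esym.
have hh : m (f - g) (f - g) = f - g.
  by rewrite amulBr !amulBl ff gf gg (mC f) gf subrr subr0.
have h_ge := idempotent_hnorm_ge hh h0.
have Ag : A (hnorm g ^+ 2) by exists g => //; split=> //; rewrite -gf -mA fe.
have := ge_inf A_inf.2 Ag.
have fE : hnorm f ^+ 2 = hnorm g ^+ 2 + hnorm (f - g) ^+ 2.
  have gh : inner g (f - g) = 0.
    by rewrite -{1}gg (idempotent_selfadj gg) amulBr gf gg subrr inner0r.
  have fgE : hnorm f = hnorm (g + (f - g)) by rewrite addrC subrK.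
  by rewrite {1}fgE hnorm_sqrD gh mulr0 addr0.
have : (M ^+ 2)^-1 <= hnorm (f - g) ^+ 2.
  rewrite -[_^-1]mul1r ler_pdivrMr ?exprn_gt0 // -exprMn mulrC.
  by rewrite expr_ge1 // mulr_ge0 ?hnorm_ge0.
by move: fA; rewrite fE; lra.
Qed.

(** The idempotent [e] produced by [z] lies in [fH], hence equals [f], and
    [z^2 = z^2 f = z^2 e = r e = r f]. *)
Lemma minimal_selfadj_sqr f z : minimal_idempotent f ->
  selfadj z -> m f z = z -> exists c : R[i], m z z = c *: f.
Proof.
move=> [ff f0 fmin] zS fz; have [z0|] := pselect (forall y, m z y = 0).
  by exists 0; rewrite z0 scale0r.
move=> /existsNP z0; have [r [e [r0 ee e0 zze]]] := selfadj_idempotent zS z0.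
have rC : r%:C != 0 by rewrite gt_eqF // ltcR.
have fe : m f e = e.
  by apply: (scalerI rC); rewrite -amulZr -zze mA fz.
have eE : e = f by apply: fmin => //; rewrite mC fe.
by exists r%:C; rewrite -eE -zze eE mA (mC _ f) mA fz.
Qed.

(** The squares of [z] and of [f + z] are both multiples of [f], and
    [(f + z)^2 = f + 2z + z^2]. *)
Lemma minimal_selfadj_scalar f z : minimal_idempotent f ->
  selfadj z -> m f z = z -> exists c : R[i], z = c *: f.
Proof.
move=> fmin zS fz; have [ff _ _] := fmin.
have [c zz] := minimal_selfadj_sqr fmin zS fz.
have [||d] := @minimal_selfadj_sqr f (f + z) fmin.
- by apply: selfadjD => //; apply: idempotent_selfadj.
- by rewrite amulDr ff fz.
rewrite amulDr !amulDl ff zz (mC z) fz => e.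
exists ((d - 1 - c) / 2); apply: (scalerI (_ : 2%:R != 0 :> R[i])) => //.
rewrite scalerA mulrCA divff // mulr1 !scalerBl scale1r -e.
rewrite (_ : (2%:R : R[i]) *: z = z + z); last first.
  by rewrite -[2%:R]/(1 + 1) scalerDl scale1r.
rewrite [RHS]addrAC [f + z + _]addrA addrK.
by rewrite -[f + z + z]addrA [f + _]addrC addrK.
Qed.

(** [s x f] plays the role of the conjugate [x'] of [x]: multiplication by it is
    the adjoint of multiplication by [x].  So [x + x'] and [i (x - x')] are
    self-adjoint, and both are multiples of [f]. *)
Lemma minimal_scalar f x : minimal_idempotent f ->
  m f x = x -> exists c : R[i], x = c *: f.
Proof.
move=> fmin fx; have [ff _ _] := fmin.
have fS := idempotent_selfadj ff.
pose x' := s x f.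
have fx' : m f x' = x' by rewrite -frob ff.
have x'P y z : inner (m x' y) z = inner y (m x z).
  by rewrite mC -frob innerC -sP -innerC (mC y) fS mA fx.
have x'P2 y z : inner y (m x' z) = inner (m x y) z.
  by rewrite innerC x'P -innerC.
have [||c xc] := @minimal_selfadj_scalar f (x + x') fmin.
- move=> y z; rewrite !amulDl innerDl innerDr x'P x'P2; exact: addrC.
- by rewrite amulDr fx fx'.
have [||d xd] := @minimal_selfadj_scalar f ('i *: (x - x')) fmin.
- move=> y z; rewrite !amulZl innerZl innerZr !amulBl innerBl innerBr x'P x'P2.
  by rewrite conjCi mulNr -mulrN opprB.
- by rewrite amulZr amulBr fx fx'.
exists ((c - 'i * d) / 2); apply: (scalerI (_ : 2%:R != 0 :> R[i])) => //.
rewrite scalerA mulrCA divff // mulr1 scalerBl -scalerA -xc -xd scalerA.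
rewrite -expr2 sqr_i scaleN1r opprK.
by rewrite -[2%:R]/(1 + 1) scalerDl scale1r addrACA subrr addr0.
Qed.

(** ** Characters *)

(** The vector representing a non-zero multiplicative linear functional. *)
Definition character g :=
  g <> 0 /\ forall x y, inner (m x y) g = inner x g * inner y g.

Lemma minimal_character f : minimal_idempotent f ->
  exists2 g, character g & forall x, m f x = inner x g *: f.
Proof.
move=> fmin; have [ff f0 _] := fmin; have fS := idempotent_selfadj ff.
have nf : (hnorm f ^+ 2)%:C != 0.
  by apply/eqP; rewrite -inner_hnorm => /inner_eq0.
pose g := ((hnorm f ^+ 2)^-1)%:C *: f.
have gP x : m f x = inner x g *: f.
  have [|c fx] := @minimal_scalar f (m f x) fmin; first by rewrite mA ff.
  have xf : inner x f = c * (hnorm f ^+ 2)%:C.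
    by rewrite -inner_hnorm -innerZl -fx fS ff.
  by rewrite fx innerZr conj_real xf mulrCA fmorphV /= mulVf // mulr1.
exists g => //; split=> [|x y].
  move/eqP; rewrite scaler_eq0 => /orP[]; last by move/eqP.
  by rewrite fmorphV /= invr_eq0 (negPf nf).
have : (inner (m x y) g - inner x g * inner y g) *: f = 0.
  by rewrite scalerBl -scalerA -!gP mA gP amulZl subrr.
by move/eqP; rewrite scaler_eq0 subr_eq0 => /orP[/eqP //|/eqP].
Qed.

(** The element [a = s_v v] acts as [L_v^* L_v], so the square of [a] acts on
    the idempotent [e] that it produces, and on any [f] below [e], through a
    non-zero scalar.  If the character of [f] vanished at [v], then [vf = 0] and
    hence [a f = L_v^* (v f) = 0]. *)
Lemma character_separates v : (exists y, m v y <> 0) ->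
  exists2 g, character g & inner v g <> 0.
Proof.
move=> [y0 vy0]; pose a := s v v.
have aE y : m a y = s v (m v y) by rewrite mC -frob mC.
have aS : selfadj a.
  by move=> y z; rewrite !aE -sP innerC -sP -innerC.
have [|r [e [r0 ee e0 aae]]] := selfadj_idempotent aS.
  exists y0 => ay0; apply: vy0; apply: inner_eq0.
  by rewrite sP -aE ay0 inner0r.
have [f fmin fe] := exists_minimal_idempotent ee e0.
have [ff f0 _] := fmin.
have [g gchar gP] := minimal_character fmin; exists g => // vg.
have vf : m v f = 0 by rewrite mC gP vg scale0r.
have af : m a f = 0.
  by apply/hnorm_eq0; rewrite aE hnorm_adj vf amul0r hnorm0.
have : r%:C *: f = 0.
  by rewrite -fe (mC f) -amulZl -aae -!mA (mC e) fe af amul0r.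
by move/eqP; rewrite scaler_eq0 gt_eqF ?ltcR //= => /eqP.
Qed.

Lemma annihilatorP v :
  (forall y, m v y = 0) <-> (forall g, character g -> inner v g = 0).
Proof.
split=> [v0 g [_ gM]|vg y].
  by have /esym/eqP := gM v v; rewrite v0 inner0l mulf_eq0 orbb => /eqP.
apply: contrapT => vy; have [|g gchar] := @character_separates v.
  by exists y.
by case; apply: vg.
Qed.

(** Multiplicativity says that [g] is an eigenvector of the adjoint of [L_x];
    since [L_x] is normal, [g] is an eigenvector of [L_x] for the conjugate
    eigenvalue. *)
Lemma character_eigen g x : character g -> m x g = inner x g *: g.
Proof.
move=> [g0 gM]; set l := inner x g.
have sg : s x g = Num.conj l *: g.
  by apply: inner_ext => z; rewrite -sP gM innerZr conjCK.
apply/eqP; rewrite -subr_eq0; apply/eqP/inner_eq0.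
rewrite innerBl !innerBr [inner (m x g) (m x g)]inner_hnorm.
rewrite -hnorm_adj -inner_hnorm sg.
rewrite !innerZl !innerZr conjCK gM [inner g (m x g)]innerC gM rmorphM /=.
rewrite -/l -innerC; ring.
Qed.

(** The product [gh] equals both [<h, g> g] and [<g, h> h].  If [<g, h>] were
    not zero, [h = cg]; comparing [<gg, h>] with [<g, h>^2] gives [c = 1]. *)
Lemma character_orthogonal g h : character g -> character h -> g <> h ->
  inner g h = 0.
Proof.
move=> gc hc gh; apply: contrapT => /eqP gh0.
have hE : h = (inner h g / inner g h) *: g.
  apply: (scalerI gh0); rewrite scalerA mulrCA divff // mulr1.
  by rewrite -character_eigen // mC character_eigen.
move: (inner h g / _) hE => c hE; have [g0 gM] := gc; have [h0 hM] := hc.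
have gg : inner g g != 0 by apply/eqP => /inner_eq0.
have c0 : c != 0 by apply/eqP => c0; apply: h0; rewrite hE c0 scale0r.
have := hM g g; rewrite hE !innerZr gM mulrACA.
move/(mulIf (mulf_neq0 gg gg)) => cc; apply: gh; rewrite hE.
suff -> : c = 1 by rewrite scale1r.
have /(congr1 Num.conj) := cc; rewrite rmorphM /= conjCK.
by rewrite -[LHS]mulr1 => /(mulfI c0).
Qed.

(** Compare the norms in [gg = |g|^2 g]. *)
Lemma character_hnorm_le g : character g -> hnorm g <= M.
Proof.
move=> gc; have [g0 _] := gc; have := mM g g.
have pg : 0 < hnorm g.
  by rewrite lt0r hnorm_ge0 andbT; apply/eqP => /hnorm_eq0.
rewrite character_eigen // hnormZ inner_hnorm cmod_real ger0_norm ?sqr_ge0 //.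
by rewrite -expr2 mulrC ler_pM2r ?exprn_gt0.
Qed.

Lemma annihilator_adj x v : (forall z, m v z = 0) -> s x v = 0.
Proof. by move=> v0; apply: hnorm_eq0; rewrite hnorm_adj mC v0 hnorm0. Qed.

End Algebra.

(** * Hilbertian Frobenius semigroups *)

Section FrobeniusSemigroup.
Context {R : realType} {H : hilbertType R} {HH : hilbertTensor H H}.
Variable mu : HH -> H.
Hypothesis muB : bounded_linear mu.

Lemma hmul_linear x (a : R[i]) y z :
  hmul mu x (a *: y + z) = a *: hmul mu x y + hmul mu x z.
Proof. by rewrite /hmul linearPr muB.1. Qed.

Lemma hmul_bounded_linear x : bounded_linear (hmul mu x).
Proof. exact: bounded_linear_comp muB (tensr_bounded_linear HH x). Qed.

Lemma hnorm_hmul_le x y :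
  hnorm (hmul mu x y) <= opnorm mu * (hnorm x * hnorm y).
Proof. by rewrite -(hnorm_tens HH); exact: (le_opnorm _ muB). Qed.

Lemma grouplikeP g : grouplike mu g <-> character (hmul mu) g.
Proof.
split=> [[g0 gE]|[g0 gM]]; split=> //.
  by move=> x y; rewrite (adjointP muB) gE tens_inner.
by apply: tens_inner_ext => x y; rewrite -(adjointP muB) gM tens_inner.
Qed.

Hypothesis muC : commutative (hmul mu).

(** Write [p # q] for elementary tensors and pair the second Frobenius
    equation at [x # y] with [a # b].  The left side is [<xy, ab>].  On the
    right, the adjoint of the map [f1], which sends [p # q] to [p # qy], sends
    [a # b] to [a # L_y^* b]; at [mu^* x] this gives [<x, a (L_y^* b)>]. *)
Lemma frobenius_hmul (Tl : hilbertTensor HH H) (Tr : hilbertTensor H HH) :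
  frobenius mu Tl Tr -> forall y a b,
  adjoint (hmul mu y) (hmul mu a b) = hmul mu a (adjoint (hmul mu y) b).
Proof.
move=> [_ frob] y a b.
have adjM := fun x => adjointP (hmul_bounded_linear x).
suff key x : inner (hmul mu x y) (hmul mu a b) =
             inner x (hmul mu a (adjoint (hmul mu y) b)).
  by apply: inner_ext => x; rewrite -adjM muC key.
(* If one of the three maps of the equation were the default zero map, the
   equation would read adjoint mu (mu z) = 0, whence mu = 0. *)
have mu0_key : (forall z, adjoint mu (mu z) = 0) ->
    inner (hmul mu x y) (hmul mu a b) =
    inner x (hmul mu a (adjoint (hmul mu y) b)).
  move=> adj0; have mu0 z : mu z = 0.
    by apply: inner_eq0; rewrite (adjointP muB) adj0 inner0r.
  by rewrite /hmul !mu0 inner0l inner0r.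
have frobE z : adjoint mu (mu z) = tensor_map Tr HH id mu
  (associator Tl Tr (tensor_map HH Tl (adjoint mu) id z)).
  exact: (congr1 (@^~ z) frob).
move: frobE; rewrite /tensor_map /associator.
case: xgetP => [F _ [FB FE]|_]; last by move=> /mu0_key.
case: xgetP => [al _ [alU alE]|_]; last first.
  by move=> adj0; apply: mu0_key => z; rewrite adj0 (linear_fct0 FB.1).
have alB := unitary_bounded_linear alU.
case: xgetP => [G _ [_ GE]|_]; last first.
  move=> adj0; apply: mu0_key => z.
  by rewrite adj0 (linear_fct0 alB.1) (linear_fct0 FB.1).
move=> frobE.
pose f1 z := F (al (tens Tl z y)).
have f1B : bounded_linear f1.
  apply: (bounded_linear_comp FB (g := fun z => al (tens Tl z y))).
  exact: (bounded_linear_comp alB (tensl_bounded_linear Tl y)).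
have f1E : adjoint f1 (tens HH a b) = tens HH a (adjoint (hmul mu y) b).
  apply: tens_inner_ext => p q; rewrite -(adjointP f1B) /f1 alE FE.
  by rewrite !tens_inner -adjM muC.
rewrite -[in LHS]/(mu _) -[hmul mu a b]/(mu (tens HH a b)).
rewrite [LHS]innerC (adjointP muB) frobE GE -/(f1 _) -innerC.
rewrite (adjointP f1B) f1E [LHS]innerC -(adjointP muB) -innerC //.
Qed.

Section Radical.
Hypotheses (muA : associative (hmul mu)).
Hypothesis frob : forall y a b,
  adjoint (hmul mu y) (hmul mu a b) = hmul mu a (adjoint (hmul mu y) b).

Lemma hmul_adjoint y x z :
  inner (hmul mu y x) z = inner x (adjoint (hmul mu y) z).
Proof. exact: adjointP (hmul_bounded_linear y) _ _. Qed.

(** The kernel is a modular ideal with relative unit [g / |g|^2], and it is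
    maximal because it has codimension one. *)
Lemma character_kernel_maximal g : character (hmul mu) g ->
  maximal_modular_ideal mu [set x | inner x g = 0].
Proof.
move=> [g0 gM]; have gg : inner g g != 0 by apply/eqP => /inner_eq0.
split.
- split=> [|a x y /= xg yg|x y /= yg]; first exact: inner0l.
    by rewrite innerDl innerZl xg yg mulr0 addr0.
  by rewrite gM yg mulr0.
- exists ((inner g g)^-1 *: g) => x /=.
  by rewrite innerBl gM innerZl mulVf // mul1r subrr.
- by move=> /seteqP[_ /(_ g Logic.I) /=]; apply/eqP.
- move=> I [_ IL _] IT gI; apply/seteqP; split=> // x Ix /=.
  apply: contrapT => /eqP xg; apply: IT; apply/seteqP; split=> // y _.
  rewrite -[y](subrK ((inner y g / inner x g) *: x)) addrC.
  by apply: IL => //; apply: gI => /=; rewrite innerBl innerZl divfK // subrr.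
Qed.

(** If [vH = 0] and [u] is a unit modulo an ideal, then [v = v - uv] belongs to
    that ideal. *)
Lemma jacobson_radicalP v :
  jacobson_radical mu v <-> forall y, hmul mu v y = 0.
Proof.
split=> [vJ|v0 M [_ [u uM] _ _]].
  apply/(annihilatorP hmul_linear muC muA (opnorm_ge0 muB) hnorm_hmul_le
    hmul_adjoint frob) => g /character_kernel_maximal; exact: vJ.
by have := uM v; rewrite muC v0 subr0.
Qed.

Lemma jacobson_radical_character v : jacobson_radical mu v <->
  forall g : grouplike mu, inner v (val g) = 0.
Proof.
apply: (iff_trans (jacobson_radicalP v)).
apply: (iff_trans (annihilatorP hmul_linear muC muA (opnorm_ge0 muB)
  hnorm_hmul_le hmul_adjoint frob v)).
split=> [vg g|vg g /grouplikeP gG].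
  by apply: vg; apply/grouplikeP; exact: set_valP.
by have := vg (exist _ g (mem_set gG)).
Qed.

(** The adjoint of any multiplication kills the radical, by normality; so every
    product is orthogonal to the radical. *)
Lemma radical_complement_mul x y :
  orthogonal_complement (jacobson_radical mu) (hmul mu x y).
Proof.
move=> v /jacobson_radicalP v0.
by rewrite hmul_adjoint (annihilator_adj muC hmul_adjoint frob) // inner0r.
Qed.

End Radical.
End FrobeniusSemigroup.

(** * Fourier coordinates along an orthogonal family *)

#[local] Existing Instance summability.totally_filter.

Section OrthogonalFamily.
Context {R : realType} {H : hilbertType R} {X : choiceType}.
Variable e : X -> H.
Hypothesis e_neq0 : forall i, e i <> 0.
Hypothesis e_ortho : forall i j, i <> j -> inner (e i) (e j) = 0.

Definition weight i : R := (hnorm (e i) ^+ 2)^-1.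

(** With the weights [1 / |e_i|^2] the coordinates need no normalization: the
    family [e] itself is orthogonal but not orthonormal. *)
Definition inner_coord (x : H) : X -> R[i]^o := fun i => inner x (e i).

(** The double orthogonal of the family, which is the closure of its linear
    span. *)
Definition closed_span : set H :=
  [set x | forall n, (forall i, inner n (e i) = 0) -> inner x n = 0].

Definition expansion (f : X -> R[i]^o) (i : X) : H :=
  ((weight i)%:C * f i) *: e i.

Definition energy (f : X -> R[i]^o) (A : {fset X}) : R :=
  \sum_(i <- A) weight i * cmod (f i) ^+ 2.

Notation psum f := (summability.partial_sum (expansion f)).

Lemma psumE (V : zmodType) (F : X -> V) (A : {fset X}) :
  summability.partial_sum F A = \sum_(i <- A) F i.
Proof. by rewrite /summability.partial_sum (big_seq_fsetE _ A predT F). Qed.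

Lemma weight_inner i : (weight i)%:C * inner (e i) (e i) = 1.
Proof.
rewrite inner_hnorm -rmorphM /= mulVf //; rewrite sqrf_eq0.
by apply/eqP => /hnorm_eq0; apply: e_neq0.
Qed.

Lemma weight_ge0 i : 0 <= weight i.
Proof. by rewrite invr_ge0 sqr_ge0. Qed.

Lemma inner_suml I (r : seq I) (F : I -> H) y :
  inner (\sum_(i <- r) F i) y = \sum_(i <- r) inner (F i) y.
Proof.
by elim/big_ind2: _ => [|u a v b <- <-|//]; rewrite ?inner0l ?innerDl.
Qed.

Lemma inner_psum f A j : inner (psum f A) (e j) = (if j \in A then f j else 0).
Proof.
rewrite psumE inner_suml; case: ifP => jA.
  rewrite (big_fsetD1 j jA) /= big1_seq ?addr0 => [|i /andP[_]].
    by rewrite innerZl mulrAC weight_inner mul1r.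
  rewrite !inE => /andP[/eqP ij _]; by rewrite innerZl e_ortho // mulr0.
rewrite big1_seq // => i /andP[_ iA]; rewrite innerZl e_ortho ?mulr0 //.
by move=> ij; rewrite -ij iA in jA.
Qed.

(** Any [g] with coordinates [f] on [A] has the same inner product with the
    partial sum over [A]: this gives at once the norm of a partial sum, the
    inner product of nested ones and the inequality of Bessel. *)
Lemma energyE f g A : (forall i, i \in A -> inner g (e i) = f i) ->
  inner g (psum f A) = (energy f A)%:C.
Proof.
move=> gf; rewrite innerC psumE inner_suml rmorph_sum /= rmorph_sum /=.
apply: eq_big_seq => i /gf gE.
rewrite innerZl rmorphM /= -innerC gE rmorphM /= conj_real.
rewrite [RHS]rmorphM /= rmorphXn /= cmodE normCK.
by rewrite -mulrA [Num.conj _ * _]mulrC.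
Qed.

Lemma hnorm_psumB f (A B : {fset X}) : (A `<=` B)%fset ->
  hnorm (psum f B - psum f A) ^+ 2 = energy f B - energy f A.
Proof.
move=> /fsubsetP AB.
have inE' (C : {fset X}) : inner (psum f C) (psum f C) = (energy f C)%:C.
  by apply: energyE => i iC; rewrite inner_psum iC.
have nE (C : {fset X}) : hnorm (psum f C) ^+ 2 = energy f C.
  by apply: (@complexI R); rewrite -inner_hnorm inE'.
rewrite hnorm_sqrB !nE energyE /= ?mulr_natl; last first.
  by move=> i /AB iB; rewrite inner_psum iB.
lra.
Qed.

Lemma bessel x A : energy (inner_coord x) A <= hnorm x ^+ 2.
Proof.
have nE : hnorm (psum (inner_coord x) A) ^+ 2 = energy (inner_coord x) A.
  apply: (@complexI R); rewrite -inner_hnorm; apply: energyE => i iA.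
  by rewrite inner_psum iA.
have := sqr_ge0 (hnorm (x - psum (inner_coord x) A)).
rewrite hnorm_sqrB nE energyE //=; lra.
Qed.

Lemma l2wP f : l2w weight f <-> exists C : R, forall A, energy f A <= C.
Proof.
have term_ge0 i : (0 <= (weight i * cmod (f i) ^+ 2)%:E)%E.
  by rewrite lee_fin mulr_ge0 ?weight_ge0 ?sqr_ge0.
have fsumE (A : {fset X}) :
    (\sum_(i \in [set` A]) (weight i * cmod (f i) ^+ 2)%:E)%E = (energy f A)%:E.
  by rewrite fsbig_finite //= set_fsetK /energy sumEFin.
split=> [fl|[C fC]].
  exists (fine (\esum_(x in [set: X]) (weight x * cmod (f x) ^+ 2)%:E)) => A.
  rewrite -lee_fin fineK; last by rewrite ge0_fin_numE ?esum_ge0.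
  by rewrite -fsumE; apply: ereal_sup_ubound; exists [set` A].
apply: (@le_lt_trans _ _ C%:E); last exact: ltry.
apply: ge_ereal_sup => _ [A [Afin _] <-].
by rewrite fsbig_finite //= sumEFin lee_fin; apply: fC.
Qed.

(** The energies of the finite subsets are nondecreasing and bounded, and
    increments of partial sums have as squared norms the increments of energy;
    so the partial sums are Cauchy along finite subsets. *)
Lemma riesz_fischer f : l2w weight f ->
  exists x, [/\ closed_span x, inner_coord x = f
  & forall d : R, 0 < d ->
      \forall A \near summability.totally, hnorm (psum f A - x) < d].
Proof.
move=> /l2wP[C fC].
have f_sup : has_sup (range (energy f)).
  split; first by exists (energy f fset0), fset0.
  by exists C => _ [A _ <-]; apply: fC.
have [|x fx] := @hilbert_complete R H _ summability.totally _
    (summability.partial_sum (expansion f)).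
  move=> d d0; have [_ [A _ <-] dA] := sup_adherent (exprn_gt0 2 d0) f_sup.
  exists (psum f A); exists A => // B /= AB.
  rewrite -ltr_sqr ?nnegrE ?hnorm_ge0 1?ltW // hnorm_psumB //.
  by have := ub_le_sup f_sup.2 (imageT (energy f) B); move: dA; lra.
have inner_lim y z :
    (forall d : R, 0 < d -> \forall A \near summability.totally,
    cmod (inner (psum f A) y - z) <= d * hnorm y) -> inner x y = z.
  move=> fz; apply/eqP; rewrite -subr_eq0; apply/eqP/cmod_eq0.
  apply: (@le_eps_eq0 _ _ (2 * hnorm y)) => d d0.
  rewrite ger0_norm ?cmod_ge0 //.
  have [A /= [Ax Az]] := filter_ex (filterI (fx d d0) (fz d d0)).
  rewrite -(subrK (inner (psum f A) y) (inner x y)) -addrA -innerBl.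
  rewrite (le_trans (cmodD _ _)) // mulrA mulr_natr mulr2n mulrDl lerD //.
  rewrite (le_trans (cauchy_schwarz _ _)) // ler_wpM2r ?hnorm_ge0 // hnormBC.
  exact: ltW.
exists x; split=> //.
  move=> n n0; apply: inner_lim => d d0; apply: nearW => A.
  rewrite subr0 psumE inner_suml big1 ?cmod_real ?normr0.
    by rewrite mulr_ge0 ?hnorm_ge0 // ltW.
  by move=> i _; rewrite innerZl innerC n0 rmorph0 mulr0.
apply/funext => j; apply: inner_lim => d d0; exists [fset j]%fset => // A /=.
rewrite fsub1set => jA; rewrite inner_psum jA subrr cmod_real normr0.
by rewrite mulr_ge0 ?hnorm_ge0 ?ltW.
Qed.

Lemma l2w_inner_coord x : l2w weight (inner_coord x).
Proof. by apply/l2wP; exists (hnorm x ^+ 2) => A; apply: bessel. Qed.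

Lemma inner_coord_inj x y : closed_span x -> closed_span y ->
  inner_coord x = inner_coord y -> x = y.
Proof.
move=> xV yV xy; apply/eqP; rewrite -subr_eq0; apply/eqP/inner_eq0.
have n0 i : inner (x - y) (e i) = 0.
  by rewrite innerBl -[inner x _]/(inner_coord x i) xy subrr.
by rewrite innerBl xV ?yV ?subrr.
Qed.

(** The inner products of [y] with the partial sums of the expansion of [x] are
    the partial sums of [l2w_inner]. *)
Lemma parseval x y : closed_span x ->
  l2w_inner weight (inner_coord x) (inner_coord y) = inner x y.
Proof.
move=> xV; have [x' [x'V x'x x'lim]] := riesz_fischer (l2w_inner_coord x).
have x'E := inner_coord_inj x'V xV x'x; move: x'lim; rewrite {}x'E => lim_x.
rewrite /l2w_inner /summability.sum.
apply: (@cvg_lim (R[i]^o : normedModType R[i])); first exact: norm_hausdorff.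
apply/cvgrPdist_lt => d d0.
have dE : (complex.Re d)%:C = d by rewrite RRe_real // gtr0_real.
have d0' : 0 < complex.Re d by rewrite -ltcR dE.
have y1 : 0 < hnorm y + 1 by rewrite ltr_wpDl ?hnorm_ge0.
have := lim_x _ (divr_gt0 d0' y1); apply: filterS => A /= xA.
have -> : summability.partial_sum
    (fun i => (weight i)%:C * inner_coord x i * Num.conj (inner_coord y i)
      : R[i]^o) A =
    inner (psum (inner_coord x) A) y.
  rewrite !psumE inner_suml; apply: eq_bigr => i _.
  by rewrite innerZl -innerC.
rewrite -innerBl -cmodE -dE ltcR (le_lt_trans (cauchy_schwarz _ _)) // hnormBC.
rewrite ltr_pdivlMr // in xA; apply: le_lt_trans xA.
by rewrite ler_wpM2l ?hnorm_ge0 // lerDl.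
Qed.

Lemma inner_coord_iso mulH mulF :
  (forall x y, inner_coord (mulH x y) = mulF (inner_coord x) (inner_coord y)) ->
  unitary_semigroup_iso closed_span inner mulH
    (l2w weight) (l2w_inner weight) mulF inner_coord.
Proof.
move=> mulE; split=> //.
- split=> [x _|x y|f fl].
  + exact: l2w_inner_coord.
  + by move=> /set_mem xV /set_mem yV; apply: inner_coord_inj.
  + by have [x [xV xf _]] := riesz_fischer fl; exists x.
- by move=> a x y _ _; apply/funext => i; rewrite /inner_coord innerDl innerZl.
- by move=> x y xV _; apply: parseval.
Qed.

End OrthogonalFamily.

Theorem proposition34 (R : realType) (H : hilbertType R)
    (HH : hilbertTensor H H) (HH_H : hilbertTensor HH H)
    (H_HH : hilbertTensor H HH) (mu : HH -> H)
    (mu_semigroup : hilbertian_semigroup mu)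
    (mu_frobenius : frobenius mu HH_H H_HH) :
  let Jperp := orthogonal_complement (jacobson_radical mu) in
  [/\ forall x y, Jperp x -> Jperp y -> Jperp (hmul mu x y),
      forall x : grouplike mu, 1 / opnorm mu ^+ 2 <= grouplike_weight x
    & exists U : H -> grouplike mu -> R[i]^o,
        unitary_semigroup_iso Jperp inner (hmul mu)
          (l2w (@grouplike_weight R H HH mu))
          (l2w_inner (@grouplike_weight R H HH mu)) l2w_mul U].
Proof.
move=> Jperp; have [muB muA muC] := mu_semigroup.
have frob := frobenius_hmul muB muC mu_frobenius.
have grouplike_character (g : grouplike mu) : character (hmul mu) (val g).
  by apply/(grouplikeP muB); exact: set_valP.
split=> [x y _ _|g|]; first exact: (radical_complement_mul muB muC muA frob).
  have g_le := character_hnorm_le (hnorm_hmul_le muB) (hmul_adjoint muB)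
    frob (grouplike_character g).
  have [g0 _] := grouplike_character g.
  have pg : 0 < hnorm (val g).
    by rewrite lt0r hnorm_ge0 andbT; apply/eqP => /hnorm_eq0.
  have pM : 0 < opnorm mu by apply: lt_le_trans g_le.
  rewrite div1r /grouplike_weight lef_pV2 ?posrE ?exprn_gt0 //.
  by rewrite ler_sqr ?nnegrE ?hnorm_ge0 ?opnorm_ge0.
pose e (g : grouplike mu) := val g.
have JperpE : Jperp = closed_span e.
  apply/seteqP; split=> x xJ v.
    by move=> /(jacobson_radical_character muB muC muA frob); exact: xJ.
  by move=> /(jacobson_radical_character muB muC muA frob); exact: xJ.
exists (inner_coord e); rewrite JperpE.
apply: (@inner_coord_iso R H _ e) => [g|g h gh|x y].
- by have [] := grouplike_character g.
- apply: (character_orthogonal muC (hmul_adjoint muB) frob) => // /val_inj.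
  exact: gh.
- by apply/funext => g; have [_ gM] := grouplike_character g; exact: gM.
Qed.
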